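(* There exists an absolute constant $c>0$ such that for every prime $p$ and every subset $A\subset\mathbb{F}_p$ with $|A|>1$, $$ \max\{|A+A|,\,|AA|\}\ \ge\ c\,\min\Bigl\{|A|^{5/3}p^{-1/3}(\log|A|)^{-1/3},\ |A|^{2/3}p^{1/3}(\log|A|)^{-1/3}\Bigr\}. $$ In particular, there exists an absolute constant $c'>0$ such that for every prime $p$ and every subset $A\subset\mathbb{F}_p$ with $1<|A|<p^{2/3}$, $$ \max\{|A+A|,\,|AA|\}\ \ge\ c'\,|A|^{5/3}p^{-1/3}(\log|A|)^{-1/3}. $$
   Context: $\mathbb{F}_p$ is the field of residue classes modulo the prime $p$. For a non-empty $A\subset\mathbb{F}_p$, the sum set is $A+A=\{a+b:\ a\in A,\ b\in A\}$ and the product set is $AA=\{ab:\ a\in A,\ b\in A\}$. $|X|$ denotes the cardinality of a finite set $X$, and $\log$ is the natural logarithm. The constants $c,c'$ do not depend on $p$ or $A$ (they are the implied constants of the Vinogradov symbol $\gg$). *)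

(* Defs.v *)
From mathcomp Require Import all_boot all_order all_algebra.

Set Implicit Arguments.
Unset Strict Implicit.
Unset Printing Implicit Defensive.

Import GRing.Theory.
Local Open Scope ring_scope.

(* Only meant for prime p: otherwise 'F_p is the field of integers modulo the
   least prime divisor of maxn p 2. *)
Definition sumset (p : nat) (A : {set 'F_p}) : {set 'F_p} :=
  [set a + b | a in A, b in A].

Definition prodset (p : nat) (A : {set 'F_p}) : {set 'F_p} :=
  [set a * b | a in A, b in A].

(* Main.v *)
Require Import Defs.
From mathcomp Require Import all_boot all_order all_algebra.
From mathcomp Require Import ring lra.
From mathcomp Require Import reals exp.

Import Order.TTheory GRing.Theory Num.Theory.
Local Open Scope ring_scope.

(** For a in A \ {0} and b in A, the line y = a (x - b) contains the |A| points
    (b + c, a c), c in A, of the grid (A + A) x AA (an idea of Elekes).  On the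
    other hand, a point set P in the affine plane over a field of q elements
    has variance at most q |P| over all lines y = m x + k, since two distinct
    points share at most one such line; so a family L of lines has
    |L| |P| / q + O(sqrt (q |L| |P|)) incidences with P.  Comparing the two
    gives |A + A| |AA| >> min (q |A|, |A|^4 / q), which, with the trivial bound
    |A + A| >= |A|, is stronger than the stated estimate even without the
    logarithm. *)

(** Cauchy-Schwarz against the constant 1: the sum of the squares of [#|D| * f i - S] is
    non-negative and equals [#|D|] times the difference of the two sides. *)
Lemma sqr_sum_le_card (R : realFieldType) (I : finType) (D : {set I})
    (f : I -> R) :
  (\sum_(i in D) f i) ^+ 2 <= #|D|%:R * \sum_(i in D) f i ^+ 2.
Proof.
have [->|D0] := eqVneq D set0; first by rewrite !big_set0 expr0n mulr0.
set S := \sum_(i in D) f i; set Q := \sum_(i in D) f i ^+ 2.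
have n_gt0 : 0 < #|D|%:R :> R by rewrite ltr0n card_gt0.
have : 0 <= \sum_(i in D) (#|D|%:R * f i - S) ^+ 2.
  by apply: sumr_ge0 => i _; exact: sqr_ge0.
suff -> : \sum_(i in D) (#|D|%:R * f i - S) ^+ 2
        = #|D|%:R * (#|D|%:R * Q - S ^+ 2).
  by rewrite pmulr_rge0 // subr_ge0.
transitivity (\sum_(i in D)
    (#|D|%:R ^+ 2 * f i ^+ 2 - (2 * #|D|%:R * S) * f i + S ^+ 2)).
  by apply: eq_bigr => i _; ring.
rewrite big_split /= big_split /= sumrN -!mulr_sumr sumr_const -mulr_natl.
by rewrite -/S -/Q; ring.
Qed.

(** * Points and non-vertical lines in the affine plane over a finite field *)

Section Incidences.
Variable F : finFieldType.
Implicit Types (P L : {set F * F}) (z w l : F * F).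

(* The pair l = (m, k) stands for the line y = m x + k. *)
Definition on_line z l := z.2 == l.1 * z.1 + l.2.

Definition line_points P l := #|[set z in P | on_line z l]|.

Lemma line_pointsE P l : line_points P l = (\sum_(z in P) on_line z l)%N.
Proof.
rewrite /line_points -sum1_card big_mkcond [RHS]big_mkcond /=.
by apply: eq_bigr => z _; rewrite inE; case: (z \in P); case: on_line.
Qed.

(** The slope [m] is free and forces the intercept [z.2 - m * z.1]; vertical lines are not encoded,
    hence [#|F|] and not [#|F| + 1]. *)
Lemma card_lines_through z : #|[set l | on_line z l]| = #|F|.
Proof.
have <- : #|[set (m, z.2 - m * z.1) | m in [set: F]]| = #|F|.
  by rewrite card_imset ?cardsT // => m n [].
apply: eq_card => -[m k]; rewrite inE /on_line /=.
apply/eqP/imsetP => [->|[n _ [-> ->]]]; last by ring.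
by exists m; rewrite // [X in X - _]addrC addrK.
Qed.

Lemma card_lines_through2 z w :
  z != w -> (#|[set l | on_line z l && on_line w l]| <= 1)%N.
Proof.
case: z w => [x y] [x' y'] zw; apply/card_le1_eqP => -[m k] [m' k'].
rewrite !inE /on_line /= => /andP[/eqP y1 /eqP y1'] /andP[/eqP y2 /eqP y2'].
(* An encoded line is the graph of a function, so distinct points on it have distinct abscissas. *)
have xx : x != x'.
  by apply: contraNneq zw => xx; rewrite y1 y1' xx.
have /eqP : (m - m') * (x - x') = 0.
  transitivity ((m * x + k - (m * x' + k)) - (m' * x + k' - (m' * x' + k'))).
    by ring.
  by rewrite -y1 -y1' -y2 -y2' subrr.
rewrite mulf_eq0 !subr_eq0 (negPf xx) orbF => /eqP mm.
by move: y1; rewrite y2 mm => /addrI ->.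
Qed.

Lemma sum_line_points P : (\sum_l line_points P l = #|F| * #|P|)%N.
Proof.
under eq_bigr do rewrite line_pointsE.
rewrite exchange_big /= mulnC -sum_nat_const; apply: eq_bigr => z _.
rewrite -(card_lines_through z) -sum1_card [RHS]big_mkcond /=.
by apply: eq_bigr => l _; rewrite inE; case: on_line.
Qed.

(** Double counting of triples of two points of [P] and a line through both: a diagonal pair has
    [#|F|] lines, any other pair at most one. *)
Lemma sum_line_points_sqr P :
  (\sum_l line_points P l ^ 2 <= #|F| * #|P| + #|P| ^ 2)%N.
Proof.
have -> : (\sum_l line_points P l ^ 2 =
    \sum_(z in P) \sum_(w in P) #|[set l | on_line z l && on_line w l]|)%N.
  under eq_bigr do rewrite line_pointsE expnS expn1 big_distrlr /=.
  rewrite exchange_big /=; apply: eq_bigr => z _.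
  rewrite exchange_big /=; apply: eq_bigr => w _.
  rewrite -sum1_card [RHS]big_mkcond /=; apply: eq_bigr => l _.
  by rewrite inE; do 2!case: on_line.
have -> : (#|F| * #|P| + #|P| ^ 2 = \sum_(z in P) (#|F| + #|P|))%N.
  by rewrite sum_nat_const mulnDr mulnC.
apply: leq_sum => z zP; rewrite (bigD1 z) //=; apply: leq_add.
  rewrite -(card_lines_through z) subset_leq_card //.
  by apply/subsetP => l; rewrite !inE andbb.
rewrite -sum1_card [leqRHS](bigD1 z) //= -[leqLHS]add0n; apply: leq_add => //.
by apply: leq_sum => w /andP[_ wz]; rewrite card_lines_through2 // eq_sym.
Qed.

(** Cauchy-Schwarz over [L], then enlarging [L] to all lines, leaves a variance. With [q = #|F|] and
    [n = #|P|], the mean of [line_points] over the [q ^+ 2] lines is [n / q], and the two moments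
    bound the sum by [q * n + n ^+ 2 - 2 * n ^+ 2 + n ^+ 2]. *)
Lemma incidence_bound (R : realFieldType) P L :
  (\sum_(l in L) ((line_points P l)%:R - #|P|%:R / #|F|%:R)) ^+ 2
    <= #|L|%:R * (#|F|%:R * #|P|%:R) :> R.
Proof.
set q : R := #|F|%:R; set n : R := #|P|%:R.
have q0 : q != 0 by rewrite pnatr_eq0 -lt0n; apply/card_gt0P; exists 0.
apply: (le_trans (sqr_sum_le_card _ _ _ _)); rewrite ler_wpM2l ?ler0n //.
apply: (@le_trans _ _ (\sum_l ((line_points P l)%:R - n / q) ^+ 2)).
  rewrite big_mkcond; apply: ler_sum => l _.
  by case: ifP => // _; exact: sqr_ge0.
have -> : \sum_l ((line_points P l)%:R - n / q) ^+ 2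
    = (\sum_l line_points P l ^ 2)%N%:R
      - 2 * n / q * (\sum_l line_points P l)%N%:R
      + q ^+ 2 * (n / q) ^+ 2.
  rewrite !natr_sum mulr_sumr -sumrN.
  have -> : q ^+ 2 * (n / q) ^+ 2 = \sum_(l : F * F) (n / q) ^+ 2.
    by rewrite sumr_const card_prod -[in RHS]mulr_natl natrM.
  by rewrite -!big_split; apply: eq_bigr => l _ /=; rewrite natrX; ring.
have : (\sum_l line_points P l ^ 2)%N%:R <= q * n + n ^+ 2.
  by rewrite /q /n -natrX -natrM -natrD ler_nat sum_line_points_sqr.
rewrite sum_line_points natrM -/q -/n.
have -> : 2 * n / q * (q * n) = 2 * n ^+ 2 by field.
have -> : q ^+ 2 * (n / q) ^+ 2 = n ^+ 2 by field.
by lra.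
Qed.

(** * Elekes's lines and the grid of sums and products *)

Lemma sum_product_incidences (A : {set F}) (a b : F) :
  a \in A -> b \in A -> a != 0 ->
  (#|A| <= line_points (setX [set (x + y)%R | x in A, y in A]
                             [set (x * y)%R | x in A, y in A])
                       (a, - (a * b))%R)%N.
Proof.
move=> aA bA a0.
have <- : #|[set (b + c, a * c) | c in A]| = #|A|.
  by rewrite card_imset // => c d [/addrI].
apply: subset_leq_card; apply/subsetP => _ /imsetP[c cA ->].
by rewrite !inE /= !imset2_f //= /on_line /=; apply/eqP; ring.
Qed.

(** A line meets the grid in [N / q] points on average. If this is below [#|A| / 2], every line of
    [L] exceeds the mean by at least [#|A| / 2], and [incidence_bound] limits such an excess. *)
Lemma sum_product_bound (R : realFieldType) (A : {set F}) :
  (1 < #|A|)%N ->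
  let N : R := #|[set x + y | x in A, y in A]|%:R
               * #|[set x * y | x in A, y in A]|%:R in
  #|F|%:R * #|A|%:R <= 2 * N \/ #|A|%:R ^+ 4 <= 8 * #|F|%:R * N.
Proof.
move=> A1 N; set a : R := #|A|%:R; set q : R := #|F|%:R.
set P := setX [set x + y | x in A, y in A] [set x * y | x in A, y in A].
have NE : N = #|P|%:R by rewrite cardsX natrM.
(* Slope 0 is left out so that distinct pairs give distinct lines. *)
set L := [set (m.1, - (m.1 * m.2)) | m in setX (A :\ 0) A].
have cL : #|L| = (#|A :\ 0%R| * #|A|)%N.
  rewrite -cardsX card_in_imset // => -[m b] [m' b'].
  rewrite !inE /= => /andP[/andP[m0 _] _] _ [<- /oppr_inj].
  by move=> /(mulfI m0) ->.
have := incidence_bound R P L.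
rewrite -NE cL natrM -/a -/q; set k : R := #|A :\ 0%R|%:R.
have a2 : 2 <= a by rewrite (ler_nat R 2).
(* Removing 0 costs at most one element, hence at most half of [A]. *)
have ka : a <= 2 * k.
  have : a <= 1 + k.
    rewrite /a /k -(natrD _ 1) ler_nat (cardsD1 0 A) leq_add2r.
    exact: leq_b1.
  by lra.
have q0 : 0 < q by rewrite ltr0n; apply/card_gt0P; exists 0.
have I_ge : k * a * (a - N / q)
    <= \sum_(l in L) ((line_points P l)%:R - N / q).
  rewrite /k {1}/a -natrM -cL mulr_natl -sumr_const.
  apply: ler_sum => l /imsetP[[m b]].
  rewrite !inE /= => /andP[/andP[m0 mA] bA] ->.
  by rewrite lerD2r ler_nat sum_product_incidences.
move=> I_le; have [|lt2] := lerP (q * a) (2 * N); [by left|right].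
have N0 : 0 <= N by rewrite NE.
have ka0 : 0 < k * a by apply: mulr_gt0; lra.
have Nq : a / 2 <= a - N / q.
  have : N / q <= a / 2 by rewrite ler_pdivrMr //; lra.
  by lra.
have h : (k * a * (a / 2)) ^+ 2 <= k * a * (q * N).
  apply: le_trans I_le; rewrite lerXn2r ?nnegrE //.
  - by apply: mulr_ge0; lra.
  - by apply: le_trans I_ge; apply: mulr_ge0; lra.
  - by apply: le_trans I_ge; rewrite ler_pM2l.
have {h} : k * a * (a / 2) ^+ 2 <= q * N.
  by rewrite -(ler_pM2l ka0); apply: le_trans h; lra.
(* The 8 arises as 2 from [ka] times 4 from the square of [a / 2]. *)
have : a ^+ 4 <= 2 * k * a ^+ 3.
  by rewrite exprS ler_wpM2r // exprn_ge0 //; lra.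
by nra.
Qed.

End Incidences.

(** * Passage to fractional exponents and the logarithm *)

Lemma leq_card_sumset (F : finFieldType) (A : {set F}) :
  (#|A| <= #|[set (x + y)%R | x in A, y in A]|)%N.
Proof.
have [->|[a aA]] := set_0Vmem A; first by rewrite cards0.
rewrite -(card_imset _ (addrI a)); apply: subset_leq_card.
by apply/subsetP => _ /imsetP[b bA ->]; rewrite imset2_f.
Qed.

(* Here u ^ 3 = |A| and v ^ 3 = p. *)
Lemma sum_product_cube_roots (R : realFieldType) (u v M : R) :
  0 < u -> u <= v -> u ^+ 3 <= M ->
  v ^+ 3 * u ^+ 3 <= 2 * M ^+ 2 \/ u ^+ 12 <= 8 * v ^+ 3 * M ^+ 2 ->
  Num.min (u ^+ 5 / v) (u ^+ 2 * v) <= 3 * M.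
Proof.
move=> u0 uv uM.
have v0 : 0 < v by lra.
have M0 : 0 < M by apply: lt_le_trans uM; rewrite exprn_gt0.
(* The first alternative bounds the second term of the minimum: [(u ^+ 2 * v) ^+ 2] is at most
   [u ^+ 3 * v ^+ 3]. The second alternative serves the first term. *)
case=> h; rewrite ge_min; apply/orP; [right|left].
  rewrite -(@ler_pXn2r _ 2) ?nnegrE //;
    [|by apply: mulr_ge0; rewrite ?exprn_ge0; lra|by lra].
  have : u ^+ 3 * v ^+ 2 * u <= u ^+ 3 * v ^+ 2 * v.
    by rewrite ler_pM2l // mulr_gt0 // exprn_gt0.
  by nra.
(* For [u ^+ 2 < v] the trivial bound [u ^+ 3 <= M] suffices. Otherwise [u ^+ 10 * v <= u ^+ 12],
   and 8 is at most the square of 3. *)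
have [vu|uv2] := lerP v (u ^+ 2); last first.
  rewrite ler_pdivrMr //.
  have : u ^+ 3 * u ^+ 2 <= M * v.
    by apply: ler_pM => //; rewrite ?exprn_ge0 //; lra.
  have : 0 < M * v by rewrite mulr_gt0.
  by nra.
rewrite -(@ler_pXn2r _ 2) ?nnegrE //;
  [|by rewrite divr_ge0 ?exprn_ge0 //; lra|by lra].
have -> : (u ^+ 5 / v) ^+ 2 = (u ^+ 10 * v) / v ^+ 3 by field; rewrite gt_eqF.
rewrite ler_pdivrMr ?exprn_gt0 //.
have : u ^+ 10 * v <= u ^+ 10 * u ^+ 2 by rewrite ler_pM2l // exprn_gt0.
have : 0 <= M ^+ 2 * v ^+ 3 by rewrite mulr_ge0 // exprn_ge0 //; lra.
by nra.
Qed.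

(** Lets the logarithmic factor be absorbed into the constant: [ln x^-1 <= x^-1 - 1] gives
    [ln x >= 1 / 2], and the cube of the left side is the inverse of [ln x]. *)
Lemma ln_powR_third_le2 (R : realType) (x : R) :
  2 <= x -> ln x `^ (- (1 / 3)) <= 2.
Proof.
move=> x2.
have x0 : 0 < x by lra.
have lnx : 1 / 2 <= ln x.
  have := @le_ln1Dx R (x^-1 - 1).
  have xV : x^-1 <= 1 / 2 by rewrite -[1 / 2]invrK lef_pV2 ?posrE; lra.
  have xV0 : 0 < x^-1 by rewrite invr_gt0.
  rewrite [X in ln X]addrC subrK lnV ?posrE //; lra.
have lnx0 : 0 < ln x by lra.
rewrite -(@ler_pXn2r _ 3) ?nnegrE ?powR_ge0 //.
rewrite -powR_mulrn ?powR_ge0 // -powRrM.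
have -> : - (1 / 3) * 3%:R = -1 :> R by lra.
rewrite powRN powRr1 ?(ltW lnx0) // -[leLHS]mul1r ler_pdivrMr //.
by lra.
Qed.

(** Cube roots [u] and [v] make all exponents integral; [u <= v] because [A] lies in a field of [p]
    elements. *)
Lemma sum_product_Fp (R : realType) (p : nat) (A : {set 'F_p}) :
  prime p -> (1 < #|A|)%N ->
  Num.min (#|A|%:R `^ (5 / 3) * p%:R `^ (- (1 / 3)))
          (#|A|%:R `^ (2 / 3) * p%:R `^ (1 / 3))
    <= 3 * Num.max #|sumset A|%:R #|prodset A|%:R :> R.
Proof.
move=> p_pr A1; set M := Num.max _ _.
set u : R := #|A|%:R `^ (1 / 3); set v : R := p%:R `^ (1 / 3).
have cF : #|'F_p| = p by rewrite card_Fp.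
have a0 : 0 < #|A|%:R :> R by rewrite ltr0n ltnW.
have uX n : #|A|%:R `^ (n%:R / 3) = u ^+ n.
  by rewrite -powR_mulrn ?powR_ge0 // -powRrM; congr (_ `^ _); lra.
have u3 : u ^+ 3 = #|A|%:R by rewrite -uX divff ?pnatr_eq0 // powRr1 // ltW.
have v3 : v ^+ 3 = p%:R.
  by rewrite -powR_mulrn ?powR_ge0 // -powRrM mul1r mulVf ?pnatr_eq0 // powRr1.
rewrite (uX 5%N) (uX 2%N) powRN -/v.
apply: sum_product_cube_roots; first by rewrite powR_gt0.
- rewrite ge0_ler_powR ?nnegrE ?ler0n ?ler_nat ?divr_ge0 //.
  by rewrite -[leqRHS]cF max_card.
- by rewrite u3 le_max ler_nat leq_card_sumset.
have SP : #|sumset A|%:R * #|prodset A|%:R <= M ^+ 2 :> R.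
  by apply: ler_pM; rewrite ?ler0n // le_max lexx ?orbT.
have -> : u ^+ 12 = #|A|%:R ^+ 4 by rewrite -u3 -exprM.
rewrite u3 v3.
case: (sum_product_bound _ R A A1); rewrite cF => h; [left|right];
  by apply: le_trans h _; rewrite ler_wpM2l // mulr_ge0.
Qed.

Theorem theorem2 (R : realType) :
  (exists c : R, 0 < c /\
     forall (p : nat) (A : {set 'F_p}), prime p -> (1 < #|A|)%N ->
       c * Num.min
             (#|A|%:R `^ (5 / 3) * p%:R `^ (- (1 / 3))
                * ln #|A|%:R `^ (- (1 / 3)))
             (#|A|%:R `^ (2 / 3) * p%:R `^ (1 / 3)
                * ln #|A|%:R `^ (- (1 / 3)))
         <= Num.max #|sumset A|%:R #|prodset A|%:R)
  /\
  (exists c' : R, 0 < c' /\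
     forall (p : nat) (A : {set 'F_p}), prime p -> (1 < #|A|)%N ->
       #|A|%:R < p%:R `^ (2 / 3) :> R ->
       c' * (#|A|%:R `^ (5 / 3) * p%:R `^ (- (1 / 3))
               * ln #|A|%:R `^ (- (1 / 3)))
         <= Num.max #|sumset A|%:R #|prodset A|%:R).
Proof.
(* Here 6 is 3 from [sum_product_Fp] times 2 from the logarithmic factor. *)
have main (p : nat) (A : {set 'F_p}) : prime p -> (1 < #|A|)%N ->
       1 / 6 * Num.min
             (#|A|%:R `^ (5 / 3) * p%:R `^ (- (1 / 3))
                * ln #|A|%:R `^ (- (1 / 3)))
             (#|A|%:R `^ (2 / 3) * p%:R `^ (1 / 3)
                * ln #|A|%:R `^ (- (1 / 3)))
         <= Num.max #|sumset A|%:R #|prodset A|%:R :> R.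
  move=> p_pr A1; rewrite -minr_pMl ?powR_ge0 //.
  have := sum_product_Fp R p A p_pr A1.
  have : ln #|A|%:R `^ (- (1 / 3)) <= 2 :> R.
    by apply: ln_powR_third_le2; rewrite (ler_nat R 2).
  set m := Num.min _ _; set M := Num.max _ _.
  have : 0 <= m by rewrite le_min !mulr_ge0 ?powR_ge0.
  by nra.
split; exists (1 / 6); (split; first by lra); first exact: main.
move=> p A p_pr A1 Ap; apply: le_trans (main p A p_pr A1).
(* Below [p ^ (2 / 3)] the first term is the minimum: the ratio of the first term to the second is
   [#|A|] over [p ^ (2 / 3)]. *)
rewrite ler_pM2l ?le_min ?lexx /=; last by lra.
have p0 : 0 < p%:R :> R by rewrite ltr0n prime_gt0.
have a0 : 0 < #|A|%:R :> R by rewrite ltr0n ltnW.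
rewrite ler_wpM2r ?powR_ge0 // powRN ler_pdivrMr ?powR_gt0 // -mulrA.
rewrite -powRD ?(gt_eqF p0) ?implybT //.
have -> : 5 / 3 = 2 / 3 + 1 :> R by lra.
have -> : 1 / 3 + 1 / 3 = 2 / 3 :> R by lra.
rewrite powRD ?(gt_eqF a0) ?implybT // powRr1 ?ler0n //.
by rewrite ler_wpM2l ?powR_ge0 // ltW.
Qed.
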